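(* Assume $\sigma_1<0$ and $\sigma_2>0$, and consider, for each $r\in\{1,3\}$ and $k\in\overline{D}^{(r)}$, the linear system $\mathcal{A}X=Y+e^{ik^3T}\mathcal{Y}$ for $X=(g_0,g_1,g_2,h_0,h_1,h_2)^\top$ (all evaluated at $(ik^3,T)$) defined in the context. This system is full rank if and only if four interface conditions are given. These conditions must be of the form $$q^{(1)}(0,t)+\beta_{14}q^{(2)}(0,t)+\beta_{15}q^{(2)}_x(0,t)+\beta_{16}q^{(2)}_{xx}(0,t)=f_1(t),$$ $$q^{(1)}_x(0,t)+\beta_{24}q^{(2)}(0,t)+\beta_{25}q^{(2)}_x(0,t)+\beta_{26}q^{(2)}_{xx}(0,t)=f_2(t),$$ $$q^{(1)}_{xx}(0,t)+\beta_{34}q^{(2)}(0,t)+\beta_{35}q^{(2)}_x(0,t)+\beta_{36}q^{(2)}_{xx}(0,t)=f_3(t),$$ $$\beta_{44}q^{(2)}(0,t)+\beta_{45}q^{(2)}_x(0,t)+\beta_{46}q^{(2)}_{xx}(0,t)=f_4(t).$$ The system is full rank whenever one or more of the following is satisfied: 1. $\beta_{35}\beta_{44}\neq\beta_{34}\beta_{45}$; 2. $\sigma_1(\beta_{34}\beta_{46}-\beta_{36}\beta_{44})\neq\sigma_2(\beta_{24}\beta_{45}-\beta_{25}\beta_{44})$; 3. $\sigma_1^2(\beta_{35}\beta_{46}-\beta_{36}\beta_{45})+\sigma_1\sigma_2(\beta_{26}\beta_{44}-\beta_{24}\beta_{46})+\sigma_2^2(\beta_{14}\beta_{45}-\beta_{15}\beta_{44})\neq0$;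 4. $\sigma_1(\beta_{26}\beta_{45}-\beta_{25}\beta_{46})\neq\sigma_2(\beta_{16}\beta_{44}-\beta_{14}\beta_{46})$; 5. $\beta_{16}\beta_{45}\neq\beta_{15}\beta_{46}$.
   Context: Interface problem: $q^{(1)}_t=\sigma_1^3 q^{(1)}_{xxx}$ for $x<0$, $0<t\le T$, and $q^{(2)}_t=\sigma_2^3 q^{(2)}_{xxx}$ for $x>0$, $0<t\le T$, where $\sigma_1,\sigma_2$ are nonzero real constants, with initial conditions $q^{(j)}(x,0)=q^{(j)}_0(x)$. It is assumed that $q^{(1)}(\cdot,t),q_0^{(1)}\in S(-\infty,0)$ and $q^{(2)}(\cdot,t),q_0^{(2)}\in S(0,\infty)$, where $S(I)$ is the space of restrictions to $I$ of Schwartz functions, and that the initial data are compatible with the interface conditions. An interface condition is an equation, for all $t$, prescribing a constant-coefficient linear combination of $\partial_x^n q^{(1)}(0,t)$ and $\partial_x^n q^{(2)}(0,t)$, $n=0,1,2$, to equal a given function $f(t)$. Standing assumption: the interface conditions are not such that the problem reduces to a pair of half-line boundary value problems (i.e. such that the problem for $q^{(1)}$ or for $q^{(2)}$ can be solved as a half-line boundary value problem without knowing the other function, the result then being used to solve the other). For $\sigma_1<0<\sigma_2$, such a reduction occurs if the conditions imply two (independent) conditions involving only $q^{(1)}$ and its derivatives at $0$, or two (independent) conditions involving only $q^{(2)}$ and its derivatives at $0$. Notation: $\alpha=e^{2\pi i/3}$; $D=\{k\in\mathbb{C}:\operatorname{Re}(ik^3)<0\}=D^{(1)}\cup D^{(3)}\cup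 D^{(5)}$ with $D^{(1)}=\{0<\arg k<\pi/3\}$, $D^{(3)}=\{2\pi/3<\arg k<\pi\}$, $D^{(5)}=\{4\pi/3<\arg k<5\pi/3\}$; bars denote closures. Put $$g_n(\omega,T)=\int_0^T e^{\omega s}\partial_x^n q^{(1)}(0,s)\,ds,\quad h_n(\omega,T)=\int_0^T e^{\omega s}\partial_x^n q^{(2)}(0,s)\,ds\quad(n=0,1,2),$$ $$\tilde f_j(\omega,T)=\int_0^T e^{\omega s}f_j(s)\,ds,$$ $\hat q^{(1)}(k,T)=\int_{-\infty}^0e^{-ikx}q^{(1)}(x,T)\,dx$ and $\hat q^{(1)}_0(k)=\int_{-\infty}^0e^{-ikx}q^{(1)}_0(x)\,dx$ for $\operatorname{Im}k\ge0$, and $\hat q^{(2)}(k,T)=\int_0^{\infty}e^{-ikx}q^{(2)}(x,T)\,dx$ and $\hat q^{(2)}_0(k)=\int_0^{\infty}e^{-ikx}q^{(2)}_0(x)\,dx$ for $\operatorname{Im}k\le0$. The linear system: for $\sigma_1<0$, $\sigma_2>0$, $r\in\{1,3\}$ and $k\in\overline{D}^{(r)}$, the valid global relations are, with $\gamma=\alpha^{r+1}$, $$e^{ik^3T}\hat q^{(1)}(\gamma k/\sigma_1,T)-\hat q^{(1)}_0(\gamma k/\sigma_1)=\sigma_1^3g_2+i\gamma k\sigma_1^2g_1-\gamma^2k^2\sigma_1g_0,$$ $$e^{ik^3T}\hat q^{(2)}(\gamma k/\sigma_2,T)-\hat q^{(2)}_0(\gamma k/\sigma_2)=-\sigma_2^3h_2-i\gamma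 k\sigma_2^2h_1+\gamma^2k^2\sigma_2h_0,$$ with $g_n,h_n$ evaluated at $(ik^3,T)$. The transform of an interface condition is obtained by replacing $\partial_x^nq^{(1)}(0,t)$, $\partial_x^nq^{(2)}(0,t)$, $f_j(t)$ by $g_n(ik^3,T)$, $h_n(ik^3,T)$, $\tilde f_j(ik^3,T)$ respectively. The two global relations together with the transforms of the given interface conditions are written $\mathcal{A}X=Y+e^{ik^3T}\mathcal{Y}$, where $\mathcal{A}=\mathcal{A}(k)$ is the coefficient matrix, $Y$ collects the known terms ($-\hat q^{(j)}_0$ and $\tilde f_j$) and $\mathcal{Y}$ collects the terms $\hat q^{(j)}(\cdot,T)$. Full rank (synonymously, solvable for $X$) means that $\det\mathcal{A}$, a polynomial in $k$, is not identically zero.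
   Formalization: ''Full rank iff four conditions'' is read as: independent admissible conditions can be full rank only if there are four, and some four are; not every four are full rank (β14=σ1, β25=σ2, β46=1, other β zero gives det A=0), so sufficiency is claimed under 1–5. *)

(* Defs.v *)
From HB Require Import structures.
From mathcomp Require Import all_boot all_order all_algebra.
From mathcomp Require Import ring complex.
From mathcomp Require Import all_classical all_reals all_analysis.

Set Implicit Arguments.
Unset Strict Implicit.
Unset Printing Implicit Defensive.

Import Order.TTheory GRing.Theory Num.Theory.
Import numFieldNormedType.Exports.
Local Open Scope classical_set_scope.
Local Open Scope ring_scope.

(* Natural-number subscripts, as ring_scope would read 1, 2, ... in nat's
   semiring structure. *)
Notation "b `_[ j , l ]" := (b j%N l%N)
  (at level 3, j at level 99, l at level 99, left associativity,
   format "b `_[ j ,  l ]").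

Section Interface.
Variable R : realType.
Local Notation C := R[i].

(* e^(i theta) *)
Definition cis (theta : R) : C := Complex (cos theta) (sin theta).

Definition alpha : C := cis (2 * pi / 3).

(* The open sector (r - 1) pi / 3 < arg k < r pi / 3; for r = 1, 3, 5 these are
   the three components of { k | Re (i k^3) < 0 }. *)
Definition sector (r : nat) : set C^o :=
  [set k | exists rho theta : R,
     [/\ 0 < rho, (r%:R - 1) * pi / 3 < theta, theta < r%:R * pi / 3
       & k = rho%:C%C * cis theta]].

(* The columns of all coefficient matrices below have type 3 + 3 and stand for
   (g_0, g_1, g_2, h_0, h_1, h_2), or for the boundary values
   (q1, q1_x, q1_xx, q2, q2_x, q2_xx)(0, t). *)

(* Right-hand side of a global relation on x < 0 with parameter s, as a linear
   form in (g_0, g_1, g_2); kappa stands for gamma k.  On x > 0 the sign is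
   reversed. *)
Definition relation_row (s : R) (kappa : C) : 'rV[C]_3 :=
  \row_(j < 3) [:: - kappa ^+ 2 * s%:C%C;
                   'i * kappa * s%:C%C ^+ 2;
                   s%:C%C ^+ 3]`_j.

Definition relations_mx (s1 s2 : R) (r : nat) (k : C) : 'M[C]_(1 + 1, 3 + 3) :=
  let kappa := alpha ^+ r.+1 * k in
  block_mx (relation_row s1 kappa) 0 0 (- relation_row s2 kappa).

(* m interface conditions are given by a coefficient matrix B, one row per
   condition.  Taking transforms in time does not change the coefficients, so B
   is also the lower part of the matrix of the linear system for X. *)
Definition system_mx (s1 s2 : R) (r : nat) m (B : 'M[C]_(m, 3 + 3)) (k : C) :
    'M[C]_(1 + 1 + m, 3 + 3) :=
  col_mx (relations_mx s1 s2 r k) B.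

(* X has six components: full rank means that some 6 x 6 minor of the matrix is
   not identically zero in k.  When m = 4 the matrix is square and this says
   that its determinant is not identically zero, see [full_rank_det].  The
   minors are polynomials in k and the closed sector is infinite, so vanishing
   identically on it is the same as being the zero polynomial. *)
Definition full_rank (s1 s2 : R) (r : nat) m (B : 'M[C]_(m, 3 + 3)) : Prop :=
  exists2 k : C, closure (sector r) k &
    exists f : 'I_(3 + 3) -> 'I_(1 + 1 + m),
      \det (rowsub f (system_mx s1 s2 r B k)) != 0.

(* For sigma_1 < 0 < sigma_2: the conditions imply two independent conditions
   on q2 alone (first disjunct) or two on q1 alone (second disjunct), implied
   conditions being the linear combinations of the rows of B. *)
Definition reduces_to_half_lines m (B : 'M[C]_(m, 3 + 3)) : Prop :=
  exists2 E : 'M[C]_(2, 3 + 3), row_free E /\ (E <= B)%MS &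
    lsubmx E = 0 \/ rsubmx E = 0.

(* The standing assumption on m given conditions, [row_free] saying that the m
   conditions are independent, so that m is their actual number. *)
Definition interface_conditions m (B : 'M[C]_(m, 3 + 3)) : Prop :=
  row_free B /\ ~ reduces_to_half_lines B.

(* The conditions with coefficients B and data f, for boundary values
   q1 n t and q2 n t of the n-th x-derivatives at (0, t), n = 0, 1, 2. *)
Definition satisfied (T : R) m (B : 'M[C]_(m, 3 + 3)) (f : R -> 'cV[C]_m)
    (q1 q2 : nat -> R -> C) : Prop :=
  forall t : R, 0 <= t <= T ->
    B *m col_mx (\col_(n < 3) q1 n t) (\col_(n < 3) q2 n t) = f t.

(* The coefficient beta_{jl}, with 1 <= j <= 4 and 4 <= l <= 6, is beta`_[j, l];
   other values of beta are irrelevant.  See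
   [satisfied_normal]. *)
Definition normal_mx (beta : nat -> nat -> C) : 'M[C]_(4, 3 + 3) :=
  \matrix_(i < 4, j < 3 + 3)
    if (j < 3)%N then (i == j :> nat)%:R else beta`_[i.+1, j.+1].

Lemma relations_mxE s1 s2 r k (g h : 'cV[C]_3) :
  let gam := alpha ^+ r.+1 in
  let c1 := s1%:C%C in let c2 := s2%:C%C in
  relations_mx s1 s2 r k *m col_mx g h =
  col_mx
    (c1 ^+ 3 * g 2 0 + 'i * gam * k * c1 ^+ 2 * g 1 0
       - gam ^+ 2 * k ^+ 2 * c1 * g 0 0)%:M
    (- c2 ^+ 3 * h 2 0 - 'i * gam * k * c2 ^+ 2 * h 1 0
       + gam ^+ 2 * k ^+ 2 * c2 * h 0 0)%:M.
Proof.
move=> gam c1 c2; rewrite /relations_mx mul_block_col !mul0mx addr0 add0r.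
have E (s : R) (u : 'cV[C]_3) :
  relation_row s (gam * k) *m u =
    (s%:C%C ^+ 3 * u 2 0 + 'i * gam * k * s%:C%C ^+ 2 * u 1 0
       - gam ^+ 2 * k ^+ 2 * s%:C%C * u 0 0)%:M.
  apply/matrixP=> i j; rewrite !ord1 !mxE !big_ord_recl big_ord0 !mxE /=.
  have -> : lift ord0 ord0 = 1 :> 'I_3 by apply/val_inj.
  have -> : lift ord0 (lift ord0 ord0) = 2 :> 'I_3 by apply/val_inj.
  by rewrite mulr1n; ring.
rewrite mulNmx !E -raddfN; congr (col_mx _ _%:M); ring.
Qed.

Lemma full_rank_det s1 s2 r (B : 'M[C]_(4, 3 + 3)) :
  full_rank s1 s2 r B <->
  exists2 k : C, closure (sector r) k &
    \det (system_mx s1 s2 r B k : 'M[C]_6) != 0.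
Proof.
split=> -[k Dk].
  move=> [f]; rewrite rowsubE => H; exists k => //; move: H.
  by rewrite (@det_mulmx _ 6) mulf_eq0 negb_or => /andP[].
by move=> H; exists k => //; exists id; rewrite rowsubE mxsub_id mul1mx.
Qed.

Lemma satisfied_normal T beta f q1 q2 :
  satisfied T (normal_mx beta) f q1 q2 <->
  forall t, 0 <= t <= T ->
  [/\ q1 0%N t + beta`_[1, 4] * q2 0%N t + beta`_[1, 5] * q2 1%N t + beta`_[1, 6] * q2 2%N t
        = f t 0 0,
      q1 1%N t + beta`_[2, 4] * q2 0%N t + beta`_[2, 5] * q2 1%N t + beta`_[2, 6] * q2 2%N t
        = f t 1 0,
      q1 2%N t + beta`_[3, 4] * q2 0%N t + beta`_[3, 5] * q2 1%N t + beta`_[3, 6] * q2 2%N t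
        = f t 2 0 &
      beta`_[4, 4] * q2 0%N t + beta`_[4, 5] * q2 1%N t + beta`_[4, 6] * q2 2%N t = f t 3 0].
Proof.
have E (t : R) (i : 'I_4) :
  (normal_mx beta *m col_mx (\col_(n < 3) q1 n t) (\col_(n < 3) q2 n t)) i 0 =
  (i == 0%N :> nat)%:R * q1 0%N t + (i == 1%N :> nat)%:R * q1 1%N t
  + (i == 2%N :> nat)%:R * q1 2%N t
  + (beta`_[i.+1, 4] * q2 0%N t + (beta`_[i.+1, 5] * q2 1%N t + beta`_[i.+1, 6] * q2 2%N t)).
  rewrite !mxE big_split_ord /= !big_ord_recl !big_ord0 !addr0.
  by rewrite !col_mxEu !col_mxEd !mxE /= !addrA.
split=> H t Tt; have {}H := H t Tt.
  by rewrite -H !E /= !mul1r !mul0r !addr0 !add0r !addrA.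
apply/matrixP=> i j; rewrite ord1 E.
case: H => H0 H1 H2 H3.
case: i => -[|[|[|[|//]]]] Hi /=;
  rewrite ?mul1r ?mul0r ?addr0 ?add0r ?addrA;
  rewrite ?H0 ?H1 ?H2 ?H3; congr (f t _ _); exact: val_inj.
Qed.

End Interface.

(* Main.v *)
Require Import Defs.
From mathcomp Require Import all_boot all_order all_algebra.
From mathcomp Require Import complex ring.
From mathcomp Require Import all_classical all_reals all_analysis.

(** Two facts carry the theorem.

    Counting.  Independent rows E = K B that vanish on the q1-block of B
    correspond to independent rows K in the left kernel of that block, a space
    of dimension m minus the rank of the block; likewise for q2.  So a set of m
    independent conditions does not reduce to half-line problems exactly when
    both 3-column blocks have rank at least m - 1 ([reduces_rankP]).  As these
    ranks are at most 3, this gives m <= 4; a nonzero 6 x 6 minor of a matrix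
    with m + 2 rows gives m >= 4 ([full_rank_ge4]).  For m = 4 the q1-block has
    rank 3, so it has a left inverse and a left kernel of dimension 1, and
    stacking the two yields the row operations that bring the conditions to
    normal form ([interface_conditions_normal]).

    Elimination.  Put x = i alpha^(r+1) k.  Divided by sigma_1 and
    - sigma_2, the homogeneous global relations read
      x^2 g_0 + x sigma_1 g_1 + sigma_1^2 g_2 = 0,
      x^2 h_0 + x sigma_2 h_1 + sigma_2^2 h_2 = 0.
    The first three conditions in normal form express the g_n through the h_l,
    and what remains is a 3 x 3 system for h_0, h_1, h_2 whose determinant
    [elimination_poly] is a polynomial in x of degree at most 4.  Its five
    coefficients are, up to nonzero factors, the five expressions of the
    criterion ([elimination_poly_eq0]).  Where it does not vanish the 6 x 6
    system has trivial kernel ([system_kernel0]), and a nonzero polynomial does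
    not vanish at all of the infinitely many points of the sector
    ([exists_sector_nonroot]).

    That four conditions can be full rank is shown by an example,
    [antidiagonal_beta], to which the criterion applies. *)

Set Implicit Arguments.
Unset Strict Implicit.
Unset Printing Implicit Defensive.

Import Order.TTheory GRing.Theory Num.Theory.
Local Open Scope ring_scope.

(** * Counting interface conditions *)

(** The left kernel of A has dimension m - \rank A. *)
Lemma row_free_kerP (F : fieldType) m p d (A : 'M[F]_(m, p)) :
  (exists2 K : 'M[F]_(d, m), row_free K & K *m A = 0) <->
  (\rank A + d <= m)%N.
Proof.
split=> [[K /eqP rK /sub_kermxP KA] | le_m].
  have := mxrankS KA; rewrite rK mxrank_ker => le_d.
  by rewrite -leq_subRL ?rank_leq_row.
have rd : (d <= \rank (kermx A))%N.
  by rewrite mxrank_ker leq_subRL ?rank_leq_row.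
exists (pid_mx d *m row_base (kermx A)).
  by rewrite /row_free mxrankMfree ?row_base_free // rank_pid_mx.
apply/sub_kermxP; apply: submx_trans (submxMl _ _) _.
by rewrite eq_row_base.
Qed.

(** Writing implied conditions as E = K B turns independence of the rows of E
    into independence of the rows of K, because B is row-free; the vanishing of
    a block of E says that K lies in the left kernel of that block of B. *)
Lemma reduces_rankP (R : realType) m (B : 'M[R[i]]_(m, 3 + 3)) :
  row_free B ->
  reduces_to_half_lines B <->
  (\rank (lsubmx B) + 2 <= m)%N \/ (\rank (rsubmx B) + 2 <= m)%N.
Proof.
move=> fB; split.
  case=> E [fE /submxP[K defE]] zE.
  have fK : row_free K.
    by move: fE; rewrite /row_free defE mxrankMfree.
  case: zE => zE; [left | right]; apply/row_free_kerP; exists K => //.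
    by rewrite mulmx_lsub -defE.
  by rewrite mulmx_rsub -defE.
case=> /row_free_kerP[K fK KB]; exists (K *m B).
- by rewrite /row_free mxrankMfree // submxMl.
- by left; rewrite -mulmx_lsub.
- by rewrite /row_free mxrankMfree // submxMl.
- by right; rewrite -mulmx_rsub.
Qed.

(** A repeated row index would make the minor vanish, so 6 rows have to be
    found among the m + 2 rows of the system.  In terms of ranks: row selection
    is a product, which cannot increase the rank. *)
Lemma full_rank_ge4 (R : realType) (s1 s2 : R) r m (B : 'M[R[i]]_(m, 3 + 3)) :
  full_rank s1 s2 r B -> (4 <= m)%N.
Proof.
case=> k _ [f]; rewrite -unitfE -[_ \is a _]/(_ \in unitmx) -row_free_unit.
move=> /eqP rk; have := rank_leq_row (system_mx s1 s2 r B k).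
suff: (6 <= \rank (system_mx s1 s2 r B k))%N by move=> /leq_trans /[apply].
by rewrite -[X in (X <= _)%N]rk rowsubE mxrankM_maxr.
Qed.

(** Rank 3 at most of the q1-block leaves at least m - 3 independent conditions
    on q2 alone, and two of them are already a reduction. *)
Lemma interface_conditions_le4 (R : realType) m (B : 'M[R[i]]_(m, 3 + 3)) :
  interface_conditions B -> (m <= 4)%N.
Proof.
case=> fB /(contra_not (reduces_rankP fB).2) nB; rewrite leqNgt; apply/negP.
move=> m_gt4; apply: nB; left; apply: leq_trans m_gt4.
by rewrite (leq_add2r 2%N _ 3) rank_leq_col.
Qed.

(** * Reduction to normal form *)

(** Row operations reducing A to an identity block over a zero row: multiplying
    a vanishing combination u of the rows by A kills the part along v and
    isolates the part along Q. *)
Lemma col_linv_ker_unit (F : fieldType) n (A : 'M[F]_(n + 1, n)) Q v :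
  Q *m A = 1%:M -> v != 0 -> v *m A = 0 -> col_mx Q v \in unitmx.
Proof.
move=> QA nzv vA; rewrite -row_free_unit -kermx_eq0.
apply/rowV0P=> u /sub_kermxP; rewrite -[u]hsubmxK mul_row_col => uP.
have u0 : lsubmx u = 0.
  move/(congr1 (mulmx^~ A)): uP.
  by rewrite mulmxDl -!mulmxA vA QA mulmx0 addr0 mul0mx mulmx1.
move: uP; rewrite u0 mul0mx add0r [rsubmx u]mx11_scalar mul_scalar_mx.
move/eqP; rewrite scaler_eq0 (negPf nzv) orbF => /eqP ->.
by rewrite raddf0 row_mx0.
Qed.

Lemma interface_conditions_normal (R : realType) (B : 'M[R[i]]_(4, 3 + 3)) :
  interface_conditions B ->
  exists2 P : 'M[R[i]]_4, P \in unitmx & exists beta, P *m B = normal_mx beta.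
Proof.
case=> fB /(contra_not (reduces_rankP fB).2) nB.
have fl : row_full (lsubmx B).
  rewrite /row_full eqn_leq rank_leq_col leqNgt; apply/negP=> lt3.
  by apply: nB; left; rewrite (leq_add2r 2%N _ 2).
have [Q QB] := row_fullP fl.
have [|v fv vB] := (row_free_kerP 1 (lsubmx B)).2.
  by rewrite (leq_add2r 1%N _ 3) rank_leq_col.
have nzv : v != 0 by rewrite -mxrank_eq0 (eqP fv).
pose P : 'M[R[i]]_4 := col_mx Q v.
exists P; first exact: (@col_linv_ker_unit _ 3 (lsubmx B)).
have Pl : lsubmx (P *m B) = (col_mx 1%:M 0 : 'M[R[i]]_(3 + 1, 3)).
  by rewrite -mulmx_lsub (@mul_col_mx _ 3 1) vB QB.
exists (fun j l => (P *m B) (inord j.-1) (inord l.-1)).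
apply/matrixP=> i j; rewrite [RHS]mxE; case: ifPn => [j3 | _]; last by rewrite !inord_val.
have -> : j = lshift 3 (Ordinal j3) by apply/val_inj.
have := congr1 (fun M : 'M[R[i]]_(3 + 1, 3) => M i (Ordinal j3)) Pl.
rewrite mxE => ->; case: (@split_ordP 3 1 i) => i' -> /=.
  by rewrite col_mxEu mxE -val_eqE.
by rewrite col_mxEd mxE /= eqn_leq [(_ <= j)%N]leqNgt (leq_trans j3) // leq_addr.
Qed.

Lemma satisfied_mulmx (R : realType) (T : R) m (P : 'M[R[i]]_m)
    (B : 'M[R[i]]_(m, 3 + 3)) f q1 q2 :
  P \in unitmx ->
  satisfied T B f q1 q2 <-> satisfied T (P *m B) (fun t => P *m f t) q1 q2.
Proof.
move=> uP; split=> H t Tt; first by rewrite -mulmxA H.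
by apply: (can_inj (mulKmx uP)); rewrite mulmxA H.
Qed.

(** * Elimination of the boundary values *)

(** The determinant of the 3 x 3 matrix with rows
      (x^2 b_1l + x c1 b_2l + c1^2 b_3l)_l,  (x^2, x c2, c2^2),  (b_4l)_l
    for l = 4, 5, 6, as a polynomial in x.  The first row is what the relation
    on x < 0 becomes after the first three conditions eliminate the g_n. *)
Definition elimination_poly (F : comRingType) (c1 c2 : F)
    (b : nat -> nat -> F) : {poly F} :=
  Poly [:: c1 ^+ 2 * c2 ^+ 2
             * (b`_[3, 5] * b`_[4, 4] - b`_[3, 4] * b`_[4, 5]);
           c1 * c2 * (c1 * (b`_[3, 4] * b`_[4, 6] - b`_[3, 6] * b`_[4, 4])
             - c2 * (b`_[2, 4] * b`_[4, 5] - b`_[2, 5] * b`_[4, 4]));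
           - (c1 ^+ 2 * (b`_[3, 5] * b`_[4, 6] - b`_[3, 6] * b`_[4, 5])
             + c1 * c2 * (b`_[2, 6] * b`_[4, 4] - b`_[2, 4] * b`_[4, 6])
             + c2 ^+ 2 * (b`_[1, 4] * b`_[4, 5] - b`_[1, 5] * b`_[4, 4]));
           c1 * (b`_[2, 6] * b`_[4, 5] - b`_[2, 5] * b`_[4, 6])
             - c2 * (b`_[1, 6] * b`_[4, 4] - b`_[1, 4] * b`_[4, 6]);
           b`_[1, 6] * b`_[4, 5] - b`_[1, 5] * b`_[4, 6]].

Lemma elimination_poly_eq0 (F : idomainType) (c1 c2 : F)
    (b : nat -> nat -> F) :
  c1 != 0 -> c2 != 0 -> elimination_poly c1 c2 b = 0 ->
  [/\ b`_[3, 5] * b`_[4, 4] = b`_[3, 4] * b`_[4, 5],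
      c1 * (b`_[3, 4] * b`_[4, 6] - b`_[3, 6] * b`_[4, 4])
        = c2 * (b`_[2, 4] * b`_[4, 5] - b`_[2, 5] * b`_[4, 4]),
      c1 ^+ 2 * (b`_[3, 5] * b`_[4, 6] - b`_[3, 6] * b`_[4, 5])
        + c1 * c2 * (b`_[2, 6] * b`_[4, 4] - b`_[2, 4] * b`_[4, 6])
        + c2 ^+ 2 * (b`_[1, 4] * b`_[4, 5] - b`_[1, 5] * b`_[4, 4]) = 0,
      c1 * (b`_[2, 6] * b`_[4, 5] - b`_[2, 5] * b`_[4, 6])
        = c2 * (b`_[1, 6] * b`_[4, 4] - b`_[1, 4] * b`_[4, 6])
    & b`_[1, 6] * b`_[4, 5] = b`_[1, 5] * b`_[4, 6]].
Proof.
move=> nz1 nz2 p0.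
have {p0} coef0 n : (elimination_poly c1 c2 b)`_n == 0 by rewrite p0 coef0.
move: (coef0 0%N) (coef0 1%N) (coef0 2%N) (coef0 3%N) (coef0 4%N).
rewrite !coef_Poly /= oppr_eq0 !mulf_eq0 (negPf nz1) (negPf nz2) /=.
by rewrite !subr_eq0 => /eqP ? /eqP ? /eqP ? /eqP ? /eqP.
Qed.

(** Cramer's rule for the 3 x 3 system in [h]: the determinant times each
    unknown is a combination of the three equations with cofactors as
    coefficients. *)
Lemma elimination_kernel (F : idomainType) (c1 c2 x : F)
    (b : nat -> nat -> F) (g h : nat -> F) :
  (elimination_poly c1 c2 b).[x] != 0 ->
  x ^+ 2 * g 0%N + x * c1 * g 1%N + c1 ^+ 2 * g 2%N = 0 ->
  x ^+ 2 * h 0%N + x * c2 * h 1%N + c2 ^+ 2 * h 2%N = 0 ->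
  (forall n, (n < 3)%N -> g n + b`_[n.+1, 4] * h 0%N + b`_[n.+1, 5] * h 1%N
                  + b`_[n.+1, 6] * h 2%N = 0) ->
  b`_[4, 4] * h 0%N + b`_[4, 5] * h 1%N + b`_[4, 6] * h 2%N = 0 ->
  forall n, (n < 3)%N -> g n = 0 /\ h n = 0.
Proof.
set p := (_).[x] => nzp E1 E2 Eg E4.
have defg n : (n < 3)%N -> g n = - (b`_[n.+1, 4] * h 0%N + b`_[n.+1, 5] * h 1%N
                  + b`_[n.+1, 6] * h 2%N).
  by move=> /Eg; rewrite -!addrA => /eqP; rewrite addr_eq0 => /eqP.
have defp : p = c1 ^+ 2 * c2 ^+ 2
             * (b`_[3, 5] * b`_[4, 4] - b`_[3, 4] * b`_[4, 5])
           + c1 * c2 * (c1 * (b`_[3, 4] * b`_[4, 6] - b`_[3, 6] * b`_[4, 4])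
             - c2 * (b`_[2, 4] * b`_[4, 5] - b`_[2, 5] * b`_[4, 4])) * x
           - (c1 ^+ 2 * (b`_[3, 5] * b`_[4, 6] - b`_[3, 6] * b`_[4, 5])
             + c1 * c2 * (b`_[2, 6] * b`_[4, 4] - b`_[2, 4] * b`_[4, 6])
             + c2 ^+ 2 * (b`_[1, 4] * b`_[4, 5] - b`_[1, 5] * b`_[4, 4])) * x ^+ 2
           + (c1 * (b`_[2, 6] * b`_[4, 5] - b`_[2, 5] * b`_[4, 6])
             - c2 * (b`_[1, 6] * b`_[4, 4] - b`_[1, 4] * b`_[4, 6])) * x ^+ 3
           + (b`_[1, 6] * b`_[4, 5] - b`_[1, 5] * b`_[4, 6]) * x ^+ 4.
  by rewrite /p /elimination_poly horner_Poly /=; ring.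
pose a l := x ^+ 2 * b 1%N l + x * c1 * b 2%N l + c1 ^+ 2 * b 3%N l.
have Ea : a 4%N * h 0%N + a 5%N * h 1%N + a 6%N * h 2%N = 0.
  by rewrite -oppr0 -[in RHS]E1 !defg // /a; ring.
have h0 : forall n, (n < 3)%N -> h n = 0.
  have reg y : p * y = 0 -> y = 0.
    by move/eqP; rewrite mulf_eq0 (negPf nzp) => /eqP.
  pose comb u v w := u * (a 4%N * h 0%N + a 5%N * h 1%N + a 6%N * h 2%N)
    + v * (x ^+ 2 * h 0%N + x * c2 * h 1%N + c2 ^+ 2 * h 2%N)
    + w * (b`_[4, 4] * h 0%N + b`_[4, 5] * h 1%N + b`_[4, 6] * h 2%N).
  have comb0 u v w : comb u v w = 0.
    by rewrite /comb Ea E2 E4 !mulr0 !addr0.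
  (* The coefficients are the cofactors of the column of h_0, h_1, h_2. *)
  case=> [|[|[|//]]] _; apply: reg; rewrite defp.
  - rewrite -[RHS](comb0 (x * c2 * b`_[4, 6] - c2 ^+ 2 * b`_[4, 5])
      (a 6%N * b`_[4, 5] - a 5%N * b`_[4, 6])
      (a 5%N * c2 ^+ 2 - a 6%N * (x * c2))) /comb /a; ring.
  - rewrite -[RHS](comb0 (c2 ^+ 2 * b`_[4, 4] - x ^+ 2 * b`_[4, 6])
      (a 4%N * b`_[4, 6] - a 6%N * b`_[4, 4])
      (a 6%N * x ^+ 2 - a 4%N * c2 ^+ 2)) /comb /a; ring.
  - rewrite -[RHS](comb0 (x ^+ 2 * b`_[4, 5] - x * c2 * b`_[4, 4])
      (a 5%N * b`_[4, 4] - a 4%N * b`_[4, 5])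
      (a 4%N * (x * c2) - a 5%N * x ^+ 2)) /comb /a; ring.
by move=> n n3; split; rewrite ?h0 // defg // !h0 // !mulr0 !addr0 oppr0.
Qed.

(** * Full rank on the closed sector *)

Lemma cis_neq0 (R : realType) (theta : R) : cis theta != 0.
Proof.
apply/eqP=> -[c0 s0]; have := cos2Dsin2 theta.
by rewrite c0 s0 expr0n addr0 => /eqP; rewrite eq_sym oner_eq0.
Qed.

(** The bisector of the sector contains infinitely many points, and [p] has
    fewer than [size p] roots. *)
Lemma exists_sector_nonroot (R : realType) r (c : R[i]) (p : {poly R[i]}) :
  c != 0 -> p != 0 -> exists2 k, closure (sector r) k & p.[c * k] != 0.
Proof.
move=> nzc nzp; apply: contrapT => noroot.
pose theta : R := (r%:R - 1 / 2) * pi / 3.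
pose k n : R[i] := (n.+1%:R : R)%:C%C * cis theta.
have third_gt0 : 0 < pi / 3 :> R by rewrite divr_gt0 ?pi_gt0.
have half_lt1 : 1 / 2 < 1 :> R by rewrite ltr_pdivrMr // mul1r ltr1n.
have kD n : closure (sector r) (k n).
  apply: subset_closure; exists n.+1%:R, theta; split=> //.
    by rewrite /theta -!mulrA ltr_pM2r // ltrD2l ltrN2.
  by rewrite /theta -!mulrA ltr_pM2r // gtrDl oppr_lt0 divr_gt0.
have inj_ck : injective (fun n => c * k n).
  move=> n n' /(mulfI nzc) /(mulIf (cis_neq0 theta)) [] /eqP.
  by rewrite eqr_nat => /eqP[].
have /(max_poly_roots nzp) : all (root p) [seq c * k n | n <- iota 0 (size p)].
  apply/allP=> _ /mapP[n _ ->]; apply: contra_notT noroot => nz.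
  by exists (k n).
by rewrite map_inj_uniq // iota_uniq size_map size_iota ltnn => /(_ isT).
Qed.

Lemma system_kernel0 (R : realType) (s1 s2 : R) r beta k
    (w : 'cV[R[i]]_(3 + 3)) :
  s1 != 0 -> s2 != 0 ->
  (elimination_poly s1%:C%C s2%:C%C beta).['i * alpha R ^+ r.+1 * k] != 0 ->
  system_mx s1 s2 r (normal_mx beta) k *m w = 0 -> w = 0.
Proof.
move=> nz1 nz2; rewrite -[w]vsubmxK; set x := _ * k => nzp.
move: (usubmx w) (dsubmx w) => g h.
rewrite mul_col_mx => /eqP; rewrite col_mx_eq0 relations_mxE col_mx_eq0.
move=> /andP[/andP[/eqP E1 /eqP E2] /eqP EB].
pose g' (n : nat) := g (inord n) 0; pose h' (n : nat) := h (inord n) 0.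
have colE (u : 'cV[R[i]]_3) : u = \col_(n < 3) u (inord n) 0.
  by apply/colP=> i; rewrite mxE inord_val.
have o0 : (0 : 'I_3) = inord 0 by apply/val_inj; rewrite /= inordK.
have o1 : (1 : 'I_3) = inord 1 by apply/val_inj; rewrite /= inordK.
have o2 : (2 : 'I_3) = inord 2 by apply/val_inj; rewrite /= inordK.
have /satisfied_normal/(_ 0)[] : satisfied 0 (normal_mx beta) (fun=> 0)
  (fun n _ => g' n) (fun n _ => h' n).
- by move=> t _; rewrite -!colE.
- by rewrite lexx.
rewrite !mxE => G1 G2 G3 G4.
(* i^2 = -1 turns - gamma^2 k^2 into x^2 in the global relations. *)
have x2 : x ^+ 2 = - (alpha R ^+ r.+1 ^+ 2 * k ^+ 2).
  by rewrite /x !exprMn sqrCi; ring.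
move/(congr1 (fun M : 'M[R[i]]_1 => M 0 0)): E1.
move/(congr1 (fun M : 'M[R[i]]_1 => M 0 0)): E2.
rewrite !mxE !mulr1n o2 o1 o0 -/(g' _) -/(h' _) => E2 E1.
have gh0 : forall n, (n < 3)%N -> g' n = 0 /\ h' n = 0.
  apply: (elimination_kernel nzp) => //.
  - apply: (@mulfI _ s1%:C%C); first by rewrite fmorph_eq0.
    by rewrite mulr0 -[RHS]E1 x2 /x /g'; ring.
  - apply: (@mulfI _ s2%:C%C); first by rewrite fmorph_eq0.
    by rewrite mulr0 -oppr0 -[in RHS]E2 x2 /x /h'; ring.
  - by case=> [|[|[|//]]].
suff [-> ->] : g = 0 /\ h = 0 by rewrite col_mx0.
by split; apply/colP=> n; rewrite mxE -[n]inord_val; case: (gh0 n).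
Qed.

Lemma full_rank_normal (R : realType) (s1 s2 : R) r beta :
  s1 != 0 -> s2 != 0 -> elimination_poly s1%:C%C s2%:C%C beta != 0 ->
  full_rank s1 s2 r (normal_mx beta).
Proof.
move=> nz1 nz2 nzp.
have nzc : 'i * alpha R ^+ r.+1 != 0.
  by rewrite mulf_neq0 ?neq0Ci ?expf_neq0 ?cis_neq0.
have [k Dk nzk] := exists_sector_nonroot r nzc nzp.
apply/full_rank_det; exists k => //.
rewrite -det_tr; apply/det0P=> -[v /negP nzv /(congr1 trmx)].
rewrite trmx_mul trmxK trmx0 => /(system_kernel0 nz1 nz2 nzk).
by move=> /(congr1 trmx); rewrite trmxK trmx0 => v0; apply: nzv; rewrite v0.
Qed.

(** The conditions that prescribe q1, q1_x + q2_xx, q1_xx + q2_x and q2.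
    They satisfy the first clause of the criterion: b_35 b_44 = 1 and
    b_34 b_45 = 0. *)
Definition antidiagonal_beta (F : pzSemiRingType) (j l : nat) : F :=
  (j + l == 8)%N%:R.

(** Both blocks have rank 3: the q1-block is an identity over a zero row, the
    q2-block a reversed identity below a zero row. *)
Lemma antidiagonal_interface_conditions (R : realType) :
  interface_conditions (normal_mx (antidiagonal_beta R[i])).
Proof.
set B := normal_mx _.
have fB : row_free B.
  apply/row_freeP; exists (pid_mx 4); apply/matrixP=> i j.
  rewrite !mxE !big_ord_recl big_ord0 !mxE /antidiagonal_beta.
  by case: i j => [[|[|[|[|//]]]] ?] [[|[|[|[|//]]]] ?];
    rewrite /= !(mulr1, mulr0, addr0, add0r).
have rl : \rank (lsubmx B) = 3%N.
  apply/eqP; rewrite -[_ == _]/(row_full _); apply/row_fullP.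
  exists (pid_mx 3); apply/matrixP=> i j.
  rewrite !mxE !big_ord_recl big_ord0 !mxE.
  by case: i j => [[|[|[|//]]] ?] [[|[|[|//]]] ?];
    rewrite /= !(mulr1, mulr0, addr0, add0r).
have rr : \rank (rsubmx B) = 3%N.
  apply/eqP; rewrite -[_ == _]/(row_full _); apply/row_fullP.
  (* Reversing the last three rows undoes the antidiagonal. *)
  exists (\matrix_(i < 3, j < 4) (i + j == 3)%N%:R); apply/matrixP=> i j.
  rewrite !mxE !big_ord_recl big_ord0 !mxE /antidiagonal_beta.
  by case: i j => [[|[|[|//]]] ?] [[|[|[|//]]] ?];
    rewrite /= !(mulr1, mulr0, addr0, add0r).
by split=> // /(reduces_rankP fB)[]; rewrite ?rl ?rr.
Qed.

(** * The theorem *)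

Theorem proposition3 (R : realType) (s1 s2 T : R) (r : nat)
    (s1_lt0 : s1 < 0) (s2_gt0 : 0 < s2) (T_gt0 : 0 < T)
    (r13 : r = 1%N \/ r = 3%N) :
  [/\ forall m : nat,
        (exists2 B : 'M[R[i]]_(m, 3 + 3),
           interface_conditions B & full_rank s1 s2 r B) <-> m = 4%N,
      forall (B : 'M[R[i]]_(4, 3 + 3)) (f : R -> 'cV[R[i]]_4),
        interface_conditions B ->
        exists (beta : nat -> nat -> R[i]) (f' : R -> 'cV[R[i]]_4),
          forall q1 q2 : nat -> R -> R[i],
            satisfied T B f q1 q2 <-> satisfied T (normal_mx beta) f' q1 q2
    & forall beta : nat -> nat -> R[i],
        let c1 := s1%:C%C in
        let c2 := s2%:C%C in
        [\/ beta`_[3, 5] * beta`_[4, 4] != beta`_[3, 4] * beta`_[4, 5],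
            c1 * (beta`_[3, 4] * beta`_[4, 6] - beta`_[3, 6] * beta`_[4, 4])
              != c2 * (beta`_[2, 4] * beta`_[4, 5] - beta`_[2, 5] * beta`_[4, 4]),
            c1 ^+ 2 * (beta`_[3, 5] * beta`_[4, 6] - beta`_[3, 6] * beta`_[4, 5])
              + c1 * c2 * (beta`_[2, 6] * beta`_[4, 4] - beta`_[2, 4] * beta`_[4, 6])
              + c2 ^+ 2 * (beta`_[1, 4] * beta`_[4, 5] - beta`_[1, 5] * beta`_[4, 4]) != 0
          | c1 * (beta`_[2, 6] * beta`_[4, 5] - beta`_[2, 5] * beta`_[4, 6])
              != c2 * (beta`_[1, 6] * beta`_[4, 4] - beta`_[1, 4] * beta`_[4, 6])
            \/ beta`_[1, 6] * beta`_[4, 5] != beta`_[1, 5] * beta`_[4, 6]] ->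
        full_rank s1 s2 r (normal_mx beta)].

Proof.
have nz1 : s1 != 0 by rewrite lt_eqF.
have nz2 : s2 != 0 by rewrite gt_eqF.
have nzc1 : s1%:C%C != 0 by rewrite fmorph_eq0.
have nzc2 : s2%:C%C != 0 by rewrite fmorph_eq0.
split.
- move=> m; split=> [[B cB rB]|->].
    by apply/eqP; rewrite eqn_leq (interface_conditions_le4 cB) (full_rank_ge4 rB).
  exists (normal_mx (antidiagonal_beta R[i])).
    exact: antidiagonal_interface_conditions.
  apply: full_rank_normal => //; apply/eqP=> /(elimination_poly_eq0 nzc1 nzc2)[].
  by rewrite /antidiagonal_beta /= !mulr1 mulr0 => /eqP; rewrite oner_eq0.
- move=> B f /interface_conditions_normal[P uP [beta PB]].
  exists beta, (fun t => P *m f t) => q1 q2; rewrite -PB.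
  exact: satisfied_mulmx.
- move=> beta c1 c2 cond; apply: full_rank_normal => //.
  apply/eqP=> /(elimination_poly_eq0 nzc1 nzc2)[e1 e2 e3 e4 e5].
  by case: cond => [||| []]; rewrite -/c1 -/c2 ?e1 ?e2 ?e3 ?e4 ?e5 eqxx.
Qed.
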